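(* Consider the pricing problem of the EVRPTWNL, with domination relations $\succeq$ on feasible partial subpaths and on feasible partial paths such that the following hold. (Domination property) (i) If $s_1,s_2$ are feasible partial subpaths with $s_1\succeq s_2$, $a\in\mathcal A$ extends both, and $s_2\oplus a$ is feasible, then $s_1\oplus a$ is feasible and $s_1\oplus a\succeq s_2\oplus a$. (ii) If $p_1,p_2$ are feasible partial paths with $p_1\succeq p_2$, $s$ is a subpath extending both, and $p_2\oplus s$ is feasible, then $p_1\oplus s$ is feasible and $p_1\oplus s\succeq p_2\oplus s$. (iii) If $s_1,s_2$ are feasible subpaths with $s_1\succeq s_2$, both extending a feasible partial path $p$, and $p\oplus s_2$ is feasible, then $p\oplus s_1$ is feasible and $p\oplus s_1\succeq p\oplus s_2$. (Technical assumption) For both subpaths and paths, one of the resources compared in the domination relation sums to the reduced cost, and one of them is nonnegative, bounded above, and strictly increasing along extensions. Then the two-phase procedure (FindNonDominatedSubpaths, followed by FindNonDominatedPaths applied to the set of subpaths returned by the first phase) terminates finitely and solves the pricing problem in the following sense: if there exists a feasible path of negative reduced cost, then the returned set of paths contains a path of negative reduced cost; otherwise it contains none, which proves that none exists.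
   Context: **Instance.** $(\mathcal V,\mathcal A)$ is a finite directed graph, $\mathcal V=\mathcal V_C\cup\mathcal V_D\cup\mathcal V_S$ a partition into customers, depots and charging stations; $T$ is the time horizon, $B$ the battery capacity, $D$ the vehicle capacity. Each arc $(i,j)$ has travel time $t_{i,j}>0$, cost $c_{i,j}>0$, battery use $b_{i,j}>0$. Each node $i$ has demand $d_i\ge 0$ and time window $[\alpha_i,\beta_i]\subseteq[0,T]$; for $i\in\mathcal V_D\cup\mathcal V_S$, $d_i=0$, $\alpha_i=0$, $\beta_i=T$. The charging function $g:\mathbb R_+\to[0,B]$ is concave, increasing, $g(0)=0$, and invertible: it is continuous, strictly increasing until it attains $B$, and $g^{-1}(b)$ is the smallest $t$ with $g(t)=b$. Set $g_C(b,t)=g(g^{-1}(b)+t)$. **Subpaths.** A partial subpath $s$ is a node sequence $(n_0,\dots,n_m)$ along arcs with $n_0\in\mathcal V_D\cup\mathcal V_S$ and $n_1,\dots,n_{m-1}\in\mathcal V_C$; it is a (complete) subpath if moreover $m\ge1$ and $n_m\in\mathcal V_D\cup\mathcal V_S$. It is feasible if there is $(t_0,b_0)$ such that, with $t_{k+1}=\max\{t_k+t_{n_k,n_{k+1}},\alpha_{n_{k+1}}\}$ and $b_{k+1}=b_k-b_{n_k,n_{k+1}}$, one has $\sum_k d_{n_k}\le D$, $b_k\in[0,B]$ and $t_k\in[\alpha_{n_k},\beta_{n_k}]$ for all $k$. An arc $a=(n_m,n')$ extends a partial subpath $s$ ending at $n_m$, giving $s\oplus a$. $T^{\rm travel}(s)=\sum_{\ell}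 t_{n_\ell,n_{\ell+1}}$. **Paths.** A partial path $p$ is a node sequence $(n_0,\dots,n_m)$ along arcs with $n_0\in\mathcal V_D$ and $n_1,\dots,n_{m-1}\in\mathcal V_C\cup\mathcal V_S$; it is a (complete) path if $m\ge1$ and $n_m\in\mathcal V_D$. It is feasible if there are charging times $\tau_k\ge0$ ($n_k\in\mathcal V_S$; put $\tau_k=0$ otherwise) such that with $t_0=0$, $b_0=B$, $t_{k+1}=\max\{t_k+\tau_k+t_{n_k,n_{k+1}},\alpha_{n_{k+1}}\}$, and $b_{k+1}=g_C(b_k,\tau_k)-b_{n_k,n_{k+1}}$ if $n_k\in\mathcal V_S$, $b_{k+1}=b_k-b_{n_k,n_{k+1}}$ otherwise, one has $\sum_k d_{n_k}\le D$, $b_k\in[0,B]$, $t_k\in[\alpha_{n_k},\beta_{n_k}]$ for all $k$. Partial paths considered in the second phase end at non-customer nodes, so they are concatenations of subpaths (or a single depot node). A subpath $s$ extends $p$ if the end node of $p$ equals the start node of $s$ and is in $\mathcal V_S$ (or $p$ is the single depot node at which $s$ starts); the concatenation is $p\oplus s$. $T^{\rm end}_{\min}(p)$ is the smallest arrival time at the last node over all charging times making $p$ feasible. **Pricing problem.** Given real vectors $\kappa,\mu$ (indexed by $\mathcal V_D$) and $\nu$ (indexed by $\mathcal V_C$), the reduced cost of a path $p$ is $\overline c(p)=c^p-\kappa_{\rm start(p)}-\mu_{\rm end(p)}-\sum_{i\in\mathcal V_C}\gamma_i^p\nu_i$, with $c^p$ the sum of arc costs and $\gamma_i^p$ the number of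 visits to $i$. Equivalently $\overline c(p)$ is the sum over arcs of $\overline c_{i,j}=c_{i,j}-\mathbb 1(i\in\mathcal V_D)\kappa_i-\mathbb 1(j\in\mathcal V_D)\mu_j-\mathbb 1(j\in\mathcal V_C)\nu_j$; the same sum defines $\overline c$ on partial paths and (partial) subpaths. The pricing problem seeks feasible paths with $\overline c(p)<0$ or a proof that none exists. **Domination.** A domination relation $\succeq$ compares only labels with the same start node and the same end node, and is defined by comparing resources (real-valued functions of labels); thus it is reflexive and transitive, and $x\succeq y$ implies $r(x)\le r(y)$ for each of the two resources named in the technical assumption (in particular $\overline c(x)\le\overline c(y)$). **FindNonDominatedSubpaths.** Start with $\mathcal S_{\rm gen}=\emptyset$ and $\mathcal S_{\rm queue}$ = all single-node partial subpaths at nodes of $\mathcal V_D\cup\mathcal V_S$. While $\mathcal S_{\rm queue}\ne\emptyset$: select $s\in\mathcal S_{\rm queue}$ with smallest $T^{\rm travel}(s)$, move it to $\mathcal S_{\rm gen}$; if $s$ is not a complete subpath, then for each arc $a$ extending $s$: if $s\oplus a$ is infeasible or dominated by some element of $\mathcal S_{\rm queue}\cup\mathcal S_{\rm gen}$, discard it; otherwise remove from $\mathcal S_{\rm queue}$ every $s'$ with $s\oplus a\succeq s'$ and add $s\oplus a$ to $\mathcal S_{\rm queue}$. Return the complete subpaths in $\mathcal S_{\rm gen}$. **FindNonDominatedPaths**$(\mathcal S^* )$. Start with $\mathcal P_{\rm gen}=\emptyset$ and $\mathcal P_{\rm queue}$ = all single-node partial paths at depots. While $\mathcal P_{\rm queue}\neq\emptyset$: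 select $p\in\mathcal P_{\rm queue}$ with smallest $T^{\rm end}_{\min}(p)$, move it to $\mathcal P_{\rm gen}$; if $p$ is not a complete path, then for each $s\in\mathcal S^*$ extending $p$: if $p\oplus s$ is infeasible or dominated by some element of $\mathcal P_{\rm queue}\cup\mathcal P_{\rm gen}$, discard it; otherwise remove from $\mathcal P_{\rm queue}$ every $p'$ with $p\oplus s\succeq p'$ and add $p\oplus s$. Return the complete paths in $\mathcal P_{\rm gen}$. *)

(* Defs.v *)
From HB Require Import structures.
From mathcomp Require Import all_boot all_order all_algebra finmap.
From mathcomp Require Import all_classical all_reals all_analysis.

Set Implicit Arguments.
Unset Strict Implicit.
Unset Printing Implicit Defensive.

Import Order.TTheory GRing.Theory Num.Theory.
Import numFieldNormedType.Exports.

Local Open Scope ring_scope.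

(* Arc data are total functions on pairs of nodes; only their values on arcs
   matter.  The three blocks of the node partition may be empty.             *)
Record instance (R : realType) (V : finType) := Instance {
  is_arc : rel V;
  customers : {set V};
  depots : {set V};
  stations : {set V};
  horizon : R;
  battery_cap : R;
  load_cap : R;
  travel_time : V -> V -> R;
  arc_cost : V -> V -> R;
  battery_use : V -> V -> R;
  demand : V -> R;
  tw_open : V -> R;
  tw_close : V -> R;
  charging : R -> R;
  nodes_cover : customers :|: depots :|: stations = [set: V]%SET;
  customers_depots_disjoint : [disjoint customers & depots];
  customers_stations_disjoint : [disjoint customers & stations];
  depots_stations_disjoint : [disjoint depots & stations];
  travel_time_gt0 : forall i j, is_arc i j -> 0 < travel_time i j;
  arc_cost_gt0 : forall i j, is_arc i j -> 0 < arc_cost i j;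
  battery_use_gt0 : forall i j, is_arc i j -> 0 < battery_use i j;
  demand_ge0 : forall i, 0 <= demand i;
  tw_within_horizon : forall i,
    [/\ 0 <= tw_open i, tw_open i <= tw_close i & tw_close i <= horizon];
  tw_facility : forall i, i \in depots :|: stations ->
    [/\ demand i = 0, tw_open i = 0 & tw_close i = horizon];
  (* [charging] is a map from the nonnegative reals to [0, battery_cap]; its
     values at negative reals are irrelevant *)
  charging_range : forall t : R, 0 <= t -> 0 <= charging t <= battery_cap;
  charging_concave : convex_function (E := R^o) [set t : R | 0 <= t]%classic
    (fun t : R => - charging t);
  charging_nondecreasing : forall t u : R,
    0 <= t -> t <= u -> charging t <= charging u;
  charging0 : charging 0 = 0;
  charging_continuous :
    {within [set t : R | 0 <= t], continuous charging}%classic;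
  charging_increasing : forall t u : R,
    0 <= t -> t < u -> charging t < battery_cap -> charging t < charging u;
  charging_full : exists2 t : R, 0 <= t & charging t = battery_cap
}.

(* 0 when A has no least element *)
Definition least (R : realType) (A : set R) : R :=
  xget 0 (A `&` lbound A)%classic.

(* A nonempty node sequence n_0, n_1, .., n_m is the pair of n_0 and of the
   list of n_1, .., n_m.                                                     *)
Definition label (V : finType) := (V * seq V)%type.

Section Labels.

Variables (R : realType) (V : finType) (I : instance R V).
Implicit Types (s p : label V) (a : V * V).

Definition nodes s : seq V := s.1 :: s.2.
Definition node s (k : nat) : V := nth s.1 (nodes s) k.
Definition first_node s : V := s.1.
Definition last_node s : V := last s.1 s.2.
Definition inner_nodes s : seq V := behead (belast s.1 s.2).
Definition arcs_of s : seq (V * V) := zip (nodes s) s.2.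

Definition add_arc s a : label V := (s.1, rcons s.2 a.2).
(* the first node of s, which is the last node of p, is not repeated *)
Definition add_subpath p s : label V := (p.1, p.2 ++ s.2).

Definition total_demand s : R := \sum_(i <- nodes s) demand I i.
Definition total_travel_time s : R :=
  \sum_(a <- arcs_of s) travel_time I a.1 a.2.
Definition total_cost s : R := \sum_(a <- arcs_of s) arc_cost I a.1 a.2.

Definition in_window (i : V) (t : R) : Prop :=
  tw_open I i <= t <= tw_close I i.
Definition in_battery (b : R) : Prop := 0 <= b <= battery_cap I.

Definition partial_subpath s : bool :=
  [&& path (is_arc I) s.1 s.2, first_node s \in depots I :|: stations I
    & all [in customers I] (inner_nodes s)].

Definition complete_subpath s : bool :=
  [&& partial_subpath s, s.2 != [::] & last_node s \in depots I :|: stations I].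

Fixpoint subpath_state (t0 b0 : R) s (k : nat) : R * R :=
  if k is k'.+1 then
    let: (t, b) := subpath_state t0 b0 s k' in
    let i := node s k' in let j := node s k in
    (Num.max (t + travel_time I i j) (tw_open I j), b - battery_use I i j)
  else (t0, b0).

Definition feasible_subpath s : Prop :=
  [/\ partial_subpath s, total_demand s <= load_cap I
    & exists t0 b0 : R, forall k, (k <= size s.2)%N ->
        in_battery (subpath_state t0 b0 s k).2 /\
        in_window (node s k) (subpath_state t0 b0 s k).1].

Definition arc_extends s a : bool :=
  [&& is_arc I a.1 a.2, a.1 == last_node s & partial_subpath (add_arc s a)].

Definition charge_inv (b : R) : R :=
  least [set t : R | 0 <= t /\ charging I t = b]%classic.
Definition charge_from (b t : R) : R := charging I (charge_inv b + t).

Definition partial_path p : bool :=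
  [&& path (is_arc I) p.1 p.2, first_node p \in depots I
    & all [in customers I :|: stations I] (inner_nodes p)].

Definition complete_path p : bool :=
  [&& partial_path p, p.2 != [::] & last_node p \in depots I].

Fixpoint path_state (tau : nat -> R) p (k : nat) : R * R :=
  if k is k'.+1 then
    let: (t, b) := path_state tau p k' in
    let i := node p k' in let j := node p k in
    (Num.max (t + tau k' + travel_time I i j) (tw_open I j),
     (if i \in stations I then charge_from b (tau k') else b)
       - battery_use I i j)
  else (0, battery_cap I).

Definition feasible_charging p (tau : nat -> R) : Prop :=
  forall k, (k <= size p.2)%N ->
    [/\ 0 <= tau k, node p k \notin stations I -> tau k = 0,
        in_battery (path_state tau p k).2
      & in_window (node p k) (path_state tau p k).1].

Definition feasible_path p : Prop :=
  [/\ partial_path p, total_demand p <= load_cap I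
    & exists tau, feasible_charging p tau].

Definition end_time_min p : R :=
  least [set t : R | exists2 tau, feasible_charging p tau
                                & t = (path_state tau p (size p.2)).1]%classic.

(* the partial paths that are a single depot or a concatenation of subpaths *)
Definition feasible_path_label p : Prop :=
  feasible_path p /\ last_node p \notin customers I.

Definition subpath_extends p s : bool :=
  [&& complete_subpath s, last_node p == first_node s
    & (first_node s \in stations I)
      || (p.2 == [::]) && (first_node s \in depots I)].

Section ReducedCost.

Variables (kappa mu nu : V -> R).

Definition path_reduced_cost p : R :=
  total_cost p - kappa (first_node p) - mu (last_node p)
  - \sum_(i in customers I) (count_mem i (nodes p))%:R * nu i.

(* On complete paths [reduced_cost] below agrees with [path_reduced_cost], since
   their inner nodes are not depots.                                         *)
Definition arc_reduced_cost (i j : V) : R :=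
  arc_cost I i j - (i \in depots I)%:R * kappa i
  - (j \in depots I)%:R * mu j - (j \in customers I)%:R * nu j.

Definition reduced_cost s : R :=
  \sum_(a <- arcs_of s) arc_reduced_cost a.1 a.2.

End ReducedCost.

(* Domination for a family of resources [res], of which less is better: a
   resource of which more is better enters with its sign changed, a set-valued
   one through its indicators.  As the index type is arbitrary, every preorder
   on labels that implies equality of the end nodes is of this form.          *)
Definition dominates (K : Type) (res : K -> label V -> R) s s' : Prop :=
  [/\ first_node s = first_node s', last_node s = last_node s'
    & forall k, res k s <= res k s'].

End Labels.

(* Data of a label-setting search: labels in L are extended by elements of E. *)
Record search (R : realType) (L : choiceType) (E : eqType) := Search {
  initial : {fset L};
  key : L -> R;
  complete : pred L;
  extensions : L -> seq E;
  extend : L -> E -> L;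
  feasible : L -> Prop;
  dominance : L -> L -> Prop
}.

Section Search.

Variables (R : realType) (L : choiceType) (E : eqType) (A : search R L E).
Implicit Types (Q G : {fset L}) (x y : L).

Definition consider G Q x : {fset L} :=
  if `[< feasible A x /\ forall y, y \in (Q `|` G)%fset -> ~ dominance A y x >]
  then (x |` [fset y in Q | `[< ~ dominance A x y >]])%fset
  else Q.

(* One iteration of the main loop, on states (queue, generated set).  Both the
   choice among the labels of smallest key and the order r in which extensions
   are examined are left open.                                               *)
Definition iteration (st st' : {fset L} * {fset L}) : Prop :=
  exists x, [/\ x \in st.1, forall y, y \in st.1 -> key A x <= key A y,
    st'.2 = (x |` st.2)%fset
    & if complete A x then st'.1 = (st.1 `\ x)%fset
      else exists2 r, perm_eq r (extensions A x)
         & st'.1 = foldl (consider st'.2) (st.1 `\ x)%fset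
                            [seq extend A x e | e <- r]].

(* every run from the given state reaches an empty queue in finitely many
   iterations *)
Inductive halts : {fset L} * {fset L} -> Prop :=
| halts_empty G : halts (fset0, G)
| halts_iteration st :
    (exists st', iteration st st') ->
    (forall st', iteration st st' -> halts st') -> halts st.

Inductive returns_from : {fset L} * {fset L} -> {fset L} -> Prop :=
| returns_empty G : returns_from (fset0, G) [fset x in G | complete A x]%fset
| returns_iteration st st' P :
    iteration st st' -> returns_from st' P -> returns_from st P.

Definition terminates : Prop := halts (initial A, fset0).

Definition returns (P : {fset L}) : Prop := returns_from (initial A, fset0) P.

End Search.

Section TwoPhases.

Variables (R : realType) (V : finType) (I : instance R V).

Definition find_nondominated_subpaths (K : Type) (res : K -> label V -> R) :
    search R (label V) (V * V)%type := {|
  initial := [fset x in [seq (i, [::]) | i in depots I :|: stations I]]%fset;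
  key := total_travel_time I;
  complete := complete_subpath I;
  extensions := fun s => enum (arc_extends I s);
  extend := @add_arc V;
  feasible := feasible_subpath I;
  dominance := dominates res
|}.

Definition find_nondominated_paths (K : Type) (res : K -> label V -> R)
    (S : {fset label V}) : search R (label V) (label V) := {|
  initial := [fset x in [seq (i, [::]) | i in depots I]]%fset;
  key := end_time_min I;
  complete := complete_path I;
  extensions := fun p => [seq s <- S | subpath_extends I p s];
  extend := @add_subpath V;
  feasible := feasible_path I;
  dominance := dominates res
|}.

End TwoPhases.

(* Main.v *)
Require Import Defs.
From HB Require Import structures.
From mathcomp Require Import all_boot all_order all_algebra finmap.
From mathcomp Require Import all_classical all_reals all_analysis.
From mathcomp Require Import lra.

Set Implicit Arguments.
Unset Strict Implicit.
Unset Printing Implicit Defensive.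

Import Order.TTheory GRing.Theory Num.Theory.
Local Open Scope ring_scope.

(** Both phases are runs of one label-setting search, and the order in which
    such a search selects labels plays no part in its correctness.  A run
    stops because every arc takes at least some fixed positive time while the
    horizon is finite, so that only finitely many labels are feasible, and
    because a generated label dominates itself, so that it is never queued
    again ([feasible_size_bounded], [search_terminates]).  When the run stops,
    every initial label, and every feasible extension of a generated label
    that is not complete, is dominated by a generated label
    ([returns_exhaustive]).

    In the first phase, domination property (i) and induction on the length
    show that every feasible partial subpath is dominated by a generated one.
    The increasing resource serves to exclude that a single node, which has to
    be extended, is dominated only by a complete subpath returning to that
    node, which is not extended.  The converse does occur: a complete subpath
    that returns to its first node may be dominated by that node alone, and
    then no returned subpath need dominate it.  By the cost resource such a
    loop has nonnegative reduced cost ([find_subpaths_dominating]).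

    These loops can be cut out.  When a vehicle skips a loop through customers
    at a station and charges there for the sum of the two charging times, it
    leaves the station no later and with at least as much battery, by
    monotonicity of the charging function; hence the rest of the path remains
    feasible ([feasible_path_cut]).  Consequently no leg of a shortest feasible
    path of negative reduced cost is a loop of nonnegative reduced cost, and
    each leg is dominated by a returned subpath ([shortest_negative_leg]).
    Properties (iii) and (ii), applied leg by leg to such a path, show that it
    is dominated by a path generated in the second phase, whose reduced cost is
    therefore negative as well ([find_paths_complete]). *)

(** * Label-setting search *)

Section SearchTheory.

Variables (R : realType) (L : choiceType) (E : eqType) (A : search R L E).
Implicit Types (Q G F : {fset L}) (x y z : L) (xs : seq L).

Hypothesis dominance_refl : forall x, dominance A x x.
Hypothesis dominance_trans : forall x y z,
  dominance A x y -> dominance A y z -> dominance A x z.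

(** The labels obtained from an initial label by extensions whose successive
    results are all feasible.  A run stores no other labels. *)
Inductive reached : L -> Prop :=
| reached_initial x : x \in initial A -> reached x
| reached_extend x e : reached x -> e \in extensions A x ->
    feasible A (extend A x e) -> reached (extend A x e).

(** The label [x] is dominated by a label in [F]. *)
Definition covered F x : Prop := exists2 y, y \in F & dominance A y x.

(** What every state [(queue, generated)] of a run satisfies.  The last clause
    is what makes the search exhaustive: each feasible extension of a label
    that has been processed is dominated by a stored label. *)
Definition search_invariant (st : {fset L} * {fset L}) : Prop :=
  [/\ forall x, x \in st.1 -> x \notin st.2,
      forall x, x \in (st.1 `|` st.2)%fset -> reached x,
      forall x, x \in initial A -> covered (st.1 `|` st.2)%fset x
    & forall x e, x \in st.2 -> ~~ complete A x -> e \in extensions A x ->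
        feasible A (extend A x e) ->
        covered (st.1 `|` st.2)%fset (extend A x e)].

Lemma mem_consider G Q x y : y \in consider A G Q x ->
  y \in Q \/ [/\ y = x, feasible A x & x \notin G].
Proof.
rewrite /consider; case: ifP => [/asboolP[fx ndom]|_]; last by left.
rewrite !inE => /orP[/eqP->|/andP[yQ _]]; last by left.
right; split=> //; apply/negP => xG.
by apply: (ndom x) (dominance_refl x); rewrite inE xG orbT.
Qed.

Lemma covered_consider G Q x z :
  covered (Q `|` G)%fset z -> covered (consider A G Q x `|` G)%fset z.
Proof.
rewrite /consider; case: ifP => // _ [y + yz].
rewrite inE => /orP[yQ|yG]; last by exists y; rewrite ?inE ?yG ?orbT.
have [xy|nxy] := pselect (dominance A x y).
  by exists x; [rewrite !inE eqxx | apply: dominance_trans yz].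
exists y => //; rewrite !inE yQ /=.
by rewrite (asboolT nxy) orbT.
Qed.

Lemma covered_considered G Q x :
  feasible A x -> covered (consider A G Q x `|` G)%fset x.
Proof.
move=> fx; have [[y yQG yx]|ncov] := pselect (covered (Q `|` G)%fset x).
  by apply: covered_consider; exists y.
exists x => //; rewrite /consider asboolT ?inE ?eqxx//.
by split=> // y yQG yx; apply: ncov; exists y.
Qed.

Lemma mem_foldl_consider G Q xs y : y \in foldl (consider A G) Q xs ->
  y \in Q \/ [/\ y \in xs, feasible A y & y \notin G].
Proof.
elim: xs Q => [|x xs IH] Q /=; first by left.
move=> /IH[/mem_consider[|[-> fx xG]]|[yxs fy yG]]; first by left.
- by right; rewrite mem_head.
- by right; rewrite in_cons yxs orbT.
Qed.

Lemma covered_foldl_consider G Q xs z :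
  covered (Q `|` G)%fset z ->
  covered (foldl (consider A G) Q xs `|` G)%fset z.
Proof.
by elim: xs Q => [|x xs IH] Q //= /(covered_consider x); apply: IH.
Qed.

Lemma covered_foldl_considered G Q xs x : x \in xs -> feasible A x ->
  covered (foldl (consider A G) Q xs `|` G)%fset x.
Proof.
elim: xs Q => [|y xs IH] Q //=; rewrite in_cons => /orP[/eqP<- fx|]; last exact: IH.
exact/covered_foldl_consider/covered_considered.
Qed.

Lemma search_invariant_initial : search_invariant (initial A, fset0).
Proof.
split=> [x|x|x xI|x e] /=; rewrite ?inE ?orbF //; first exact: reached_initial.
by exists x; rewrite ?inE ?xI.
Qed.

Lemma search_invariant_iteration st st' :
  iteration A st st' -> search_invariant st -> search_invariant st'.
Proof.
case: st st' => [Q G] [Q' G'] [x [/= xQ _ -> step]] [/= disj reach init closed].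
have moved z : covered (Q `|` G)%fset z ->
    covered ((Q `\ x) `|` (x |` G))%fset z.
  move=> [y yQG yz]; exists y => //; move: yQG; rewrite !inE.
  by have [->|_] := eqVneq y x.
have reach_moved z : z \in ((Q `\ x) `|` (x |` G))%fset -> reached z.
  rewrite !inE => /orP[/andP[_ zQ]|/orP[/eqP->|zG]]; apply: reach;
  by rewrite inE ?zQ ?xQ ?zG ?orbT.
have disj_moved z : z \in (Q `\ x)%fset -> z \notin (x |` G)%fset.
  by rewrite !inE => /andP[/negbTE-> /disj].
case: ifP step => [cx ->|/negbT ncx [r perm_r ->]].
  split=> //= [z /init/moved //|z e]; rewrite in_fset1U => /orP[/eqP->|zG ncz ez fz].
    by rewrite cx.
  exact/moved/closed.
have mem_r e : (e \in r) = (e \in extensions A x) by apply: perm_mem.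
split=> /= [z|z|z zI|z e].
- by move=> /mem_foldl_consider[/disj_moved //|[]].
- rewrite inE => /orP[/mem_foldl_consider[zQ|[zxs fz _]]|zG].
  + by apply: reach_moved; rewrite inE zQ.
  + case/mapP: zxs fz => e; rewrite mem_r => ex -> fe; apply: reached_extend => //.
    by apply: reach; rewrite inE xQ.
  + by apply: reach_moved; rewrite inE zG orbT.
- exact/covered_foldl_consider/moved/init.
- rewrite in_fset1U => /orP[/eqP-> _ ex fe|zG ncz ez fz].
    by apply: covered_foldl_considered => //; apply: map_f; rewrite mem_r.
  exact/covered_foldl_consider/moved/closed.
Qed.

Lemma iteration_exists Q G : Q != fset0 -> exists st', iteration A (Q, G) st'.
Proof.
case/fset0Pn => x0 x0Q.
have [x _ xmin] := @arg_minP _ _ Q [` x0Q]%fset xpredT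
  (fun y : Q => key A (val y)) isT.
exists ((if complete A (val x) then (Q `\ val x)%fset else
         foldl (consider A (val x |` G)%fset) (Q `\ val x)%fset
           [seq extend A (val x) e | e <- extensions A (val x)]),
        (val x |` G)%fset).
exists (val x); split=> //=.
  by move=> y yQ; exact: (xmin [` yQ]%fset).
by case: (complete A (val x)) => //; exists (extensions A (val x)).
Qed.

(** The generated set grows at every iteration, because a label that has been
    generated dominates itself and is never queued again. *)
Lemma search_terminates (U : {fset L}) :
  (forall x, reached x -> x \in U) -> terminates A.
Proof.
move=> sub_U; rewrite /terminates.
suff halt n st : (#|` U| - #|` st.2| < n)%N -> search_invariant st -> halts A st.
  exact: halt (ltnSn _) search_invariant_initial.
elim: n st => [|n IH] [Q G] //= size_lt inv_st.
have [->|Qn0] := eqVneq Q fset0; first exact: halts_empty.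
apply: halts_iteration => [|st' step]; first exact: iteration_exists.
have inv_st' := search_invariant_iteration step inv_st.
apply: IH => //; case: step => x [/= xQ _ -> _].
have [/= disj reach _ _] := inv_st.
have : (x |` G `<=` U)%fset.
  apply/fsubsetP => y yxG; apply/sub_U/reach; move: yxG; rewrite !inE.
  by case/orP=> [/eqP->|->]; rewrite ?xQ ?orbT.
move=> /fsubset_leq_card; rewrite cardfsU1 (disj _ xQ) add1n => ltGU.
by rewrite (leq_trans _ (size_lt : (_ <= n)%N)) // ltn_sub2l.
Qed.

(** The labels generated by a run that returned [P]. *)
Lemma returns_exhaustive P : returns A P -> exists G,
  [/\ P = [fset x in G | complete A x]%fset,
      forall x, x \in G -> reached x,
      forall x, x \in initial A -> covered G x
    & forall x e, x \in G -> ~~ complete A x -> e \in extensions A x ->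
        feasible A (extend A x e) -> covered G (extend A x e)].
Proof.
rewrite /returns; move: search_invariant_initial.
set st := (initial A, fset0); move=> inv ret.
elim: ret inv => {st P} [G [_ reach init closed]|st st' P step _ IH inv].
  by exists G; move: reach init closed; rewrite /= fset0U; split.
exact/IH/(search_invariant_iteration step).
Qed.

End SearchTheory.

(** * Node sequences *)

Section NodeSequences.

Variables (R : realType) (V : finType) (I : instance R V).
Implicit Types (i j : V) (l : seq V) (s p : label V).

Lemma node_catl i l1 l2 k :
  (k <= size l1)%N -> node (i, l1 ++ l2) k = node (i, l1) k.
Proof. by move=> kl; rewrite /node /nodes /= -cat_cons nth_cat /= ltnS kl. Qed.

Lemma node_catr i l1 l2 k : (k <= size l2)%N ->
  node (i, l1 ++ l2) (size l1 + k) = node (last i l1, l2) k.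
Proof.
rewrite /node /nodes /= => kl; rewrite -cat_cons (lastI i l1) cat_rcons.
rewrite nth_cat size_belast ltnNge leq_addr /= addKn.
by apply: set_nth_default; rewrite /= ltnS.
Qed.

Lemma node_last s : node s (size s.2) = last_node s.
Proof. by rewrite /node /last_node (last_nth s.1). Qed.

Lemma inner_nodes_cat i l1 l2 : l2 != [::] ->
  inner_nodes (i, l1 ++ l2) = l1 ++ inner_nodes (last i l1, l2).
Proof.
case: l2 => // j l2 _; rewrite /inner_nodes /= belast_cat /=.
by rewrite -cat_rcons -lastI.
Qed.

Lemma mem_inner_nodes (P : pred V) s k :
  all P (inner_nodes s) -> (0 < k < size s.2)%N -> P (node s k).
Proof.
case: s k => [i l] [|k] //=; case/lastP: l => // l j.
rewrite -cats1 inner_nodes_cat // cats0 => /allP Pl; rewrite size_cat addn1 ltnS.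
by move=> kl; apply: Pl; rewrite /node /= nth_cat kl mem_nth.
Qed.

Lemma last_inner_node (P : pred V) i l1 l2 : all P (inner_nodes (i, l1 ++ l2)) ->
  l1 != [::] -> l2 != [::] -> P (last i l1).
Proof.
move=> + l10 l20; rewrite inner_nodes_cat // all_cat => /andP[/allP Pl1 _].
by apply: Pl1; case: (l1) l10 => //= j l _; apply: mem_last.
Qed.

Lemma node_arc (e : rel V) s k :
  path e s.1 s.2 -> (k < size s.2)%N -> e (node s k) (node s k.+1).
Proof. by move=> /(pathP s.1); apply. Qed.

Lemma all_inner_nodes_prefix (P : pred V) i l1 l2 :
  all P (inner_nodes (i, l1 ++ l2)) -> all P (inner_nodes (i, l1)).
Proof.
have [->|l20] := eqVneq l2 [::]; first by rewrite cats0.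
rewrite inner_nodes_cat // all_cat => /andP[+ _].
case/lastP: l1 => // l1 j; rewrite -{2}cats1 inner_nodes_cat // cats0.
by rewrite all_rcons => /andP[].
Qed.

Lemma partial_subpath_prefix i l1 l2 :
  partial_subpath I (i, l1 ++ l2) -> partial_subpath I (i, l1).
Proof.
case/and3P; rewrite /= cat_path => /andP[p1 _] fi /all_inner_nodes_prefix c1.
exact/and3P.
Qed.

Lemma partial_path_prefix i l1 l2 :
  partial_path I (i, l1 ++ l2) -> partial_path I (i, l1).
Proof.
case/and3P; rewrite /= cat_path => /andP[p1 _] fi /all_inner_nodes_prefix c1.
exact/and3P.
Qed.

Lemma total_demand_cat i l1 l2 :
  total_demand I (i, l1 ++ l2) =
  total_demand I (i, l1) + \sum_(j <- l2) demand I j.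
Proof. by rewrite /total_demand /nodes /= -cat_cons big_cat. Qed.

Lemma sum_demand_ge0 l : 0 <= \sum_(j <- l) demand I j.
Proof. by apply: sumr_ge0 => j _; apply: demand_ge0. Qed.

Lemma total_demand_prefix i l1 l2 :
  total_demand I (i, l1) <= total_demand I (i, l1 ++ l2).
Proof. by rewrite total_demand_cat lerDl sum_demand_ge0. Qed.

Lemma total_demand_suffix i l1 l2 :
  total_demand I (last i l1, l2) <= total_demand I (i, l1 ++ l2).
Proof.
rewrite /total_demand /nodes /= -cat_cons (lastI i l1) cat_rcons big_cat /=.
by rewrite lerDr sum_demand_ge0.
Qed.

Lemma arcs_of_cat i l1 l2 :
  arcs_of (i, l1 ++ l2) = arcs_of (i, l1) ++ arcs_of (last i l1, l2).
Proof. by rewrite /arcs_of /nodes /=; elim: l1 i => //= j l1 IH i; rewrite IH. Qed.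

Lemma reduced_cost_cat kappa mu nu i l1 l2 :
  reduced_cost I kappa mu nu (i, l1 ++ l2) =
  reduced_cost I kappa mu nu (i, l1) +
  reduced_cost I kappa mu nu (last i l1, l2).
Proof. by rewrite /reduced_cost arcs_of_cat big_cat. Qed.

Lemma reduced_cost_nil kappa mu nu i : reduced_cost I kappa mu nu (i, [::]) = 0.
Proof. by rewrite /reduced_cost big_nil. Qed.

Lemma subpath_state_prefix t b i l1 l2 k : (k <= size l1)%N ->
  subpath_state I t b (i, l1 ++ l2) k = subpath_state I t b (i, l1) k.
Proof.
elim: k => //= k IH kl.
by rewrite IH ?node_catl // ltnW.
Qed.

Lemma path_state_prefix tau i l1 l2 k : (k <= size l1)%N ->
  path_state I tau (i, l1 ++ l2) k = path_state I tau (i, l1) k.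
Proof.
elim: k => //= k IH kl.
by rewrite IH ?node_catl // ltnW.
Qed.

Lemma feasible_subpath_prefix i l1 l2 :
  feasible_subpath I (i, l1 ++ l2) -> feasible_subpath I (i, l1).
Proof.
case=> /partial_subpath_prefix part dem [t [b run]]; split=> //.
  exact/(le_trans (total_demand_prefix _ _ _))/dem.
exists t, b => k kl; rewrite -(subpath_state_prefix _ _ _ l2) //.
rewrite -(node_catl _ l2) //; apply: run.
by rewrite size_cat (leq_trans kl) ?leq_addr.
Qed.

Lemma feasible_charging_prefix tau i l1 l2 :
  feasible_charging I (i, l1 ++ l2) tau -> feasible_charging I (i, l1) tau.
Proof.
move=> run k kl; rewrite -(path_state_prefix _ _ l2) // -(node_catl _ l2) //.
by apply: run; rewrite size_cat (leq_trans kl) ?leq_addr.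
Qed.

Lemma feasible_path_prefix i l1 l2 :
  feasible_path I (i, l1 ++ l2) -> feasible_path I (i, l1).
Proof.
case=> /partial_path_prefix part dem [tau run]; split=> //.
  exact/(le_trans (total_demand_prefix _ _ _))/dem.
by exists tau; apply: feasible_charging_prefix run.
Qed.

(** The last leg [l2] of a node sequence: its inner nodes are customers, and it
    starts either at the first node of the sequence or at a later node that is
    not a customer. *)
Lemma last_leg i l : l != [::] -> exists l1 l2,
  [/\ l = l1 ++ l2, l2 != [::],
      (l1 == [::]) || (last i l1 \notin customers I)
    & all [in customers I] (inner_nodes (last i l1, l2))].
Proof.
elim/last_ind: l => // l j IH _.
have [->|l0] := eqVneq l [::]; first by exists [::], [:: j].
have [ci|nci] := boolP (last i l \in customers I); last first.
  by exists l, [:: j]; rewrite cats1 nci orbT.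
have [l1 [l2 [El l20 start inner]]] := IH l0.
exists l1, (rcons l2 j); rewrite -rcons_cat El start; split=> //.
  by case: (l2).
rewrite -cats1 inner_nodes_cat // cats0.
case/lastP: l2 l20 inner El => // l2 j2 _.
rewrite -{1}cats1 inner_nodes_cat // cats0 all_rcons => -> El.
by move: ci; rewrite El last_cat last_rcons /= => ->.
Qed.

(** * Finitely many feasible labels *)

Lemma travel_time_bounded_below : exists2 eps : R, 0 < eps &
  forall i j, is_arc I i j -> eps <= travel_time I i j.
Proof.
exists (\big[Order.min/1]_(a : V * V | is_arc I a.1 a.2) travel_time I a.1 a.2).
  by apply/bigmin_gtP; split=> // a /travel_time_gt0.
by move=> i j aij; exact: (@bigmin_le_cond _ _ _ _ (i, j)).
Qed.

Lemma subpath_state_time_ge eps t b s k :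
  (forall i j, is_arc I i j -> eps <= travel_time I i j) ->
  path (is_arc I) s.1 s.2 -> (k <= size s.2)%N ->
  t + eps *+ k <= (subpath_state I t b s k).1.
Proof.
move=> epsP arcs; elim: k => [|k IH] kl /=; first by rewrite addr0.
move: (IH (ltnW kl)) (epsP _ _ (node_arc arcs kl)).
case: (subpath_state I t b s k) => t' b' /= le1 le2.
by rewrite le_max mulrSr addrA lerD.
Qed.

Lemma path_state_time_ge eps tau p k :
  (forall i j, is_arc I i j -> eps <= travel_time I i j) ->
  path (is_arc I) p.1 p.2 -> (k <= size p.2)%N ->
  feasible_charging I p tau -> eps *+ k <= (path_state I tau p k).1.
Proof.
move=> epsP arcs + run; elim: k => [|k IH] kl //=.
move: (IH (ltnW kl)) (epsP _ _ (node_arc arcs kl)).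
have [tau0 _ _ _] := run k (ltnW kl).
case: (path_state I tau p k) => t' b' /= le1 le2.
rewrite le_max mulrSr; apply/orP; left.
by rewrite lerD // -[leLHS]addr0 lerD.
Qed.

(** Every arc takes at least a fixed time and the horizon is finite, so
    feasible labels have bounded length. *)
Lemma feasible_size_bounded : exists N, forall s,
  feasible_subpath I s \/ feasible_path I s -> (size s.2 <= N)%N.
Proof.
have [eps eps0 epsP] := travel_time_bounded_below.
have size_le s : eps *+ size s.2 <= horizon I ->
    (size s.2 <= Num.truncn (horizon I / eps))%N.
  move=> le_hor; have h0 : 0 <= horizon I.
    by apply: le_trans le_hor; rewrite mulrn_wge0 // ltW.
  rewrite -ltnS -(ltr_nat R) (le_lt_trans _ (truncnS_gt _)) //.
  by rewrite ler_pdivlMr // mulr_natl.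
exists (Num.truncn (horizon I / eps)) => s feas; apply: size_le.
have [_ _ leT] := tw_within_horizon I (last_node s).
apply: le_trans leT; case: feas => [[/and3P[arcs _ _] _ [t [b run]]]|].
  case: (run _ (leqnn _)) => _ /andP[_]; rewrite node_last; apply: le_trans.
  case: (run 0%N isT) => _ /andP[t0 _].
  have [ge0 _ _] := tw_within_horizon I (node s 0).
  apply: le_trans (subpath_state_time_ge t b epsP arcs (leqnn _)).
  by rewrite lerDr (le_trans ge0).
case=> /and3P[arcs _ _] _ [tau run].
case: (run _ (leqnn _)) => _ _ _ /andP[_]; rewrite node_last; apply: le_trans.
exact: path_state_time_ge.
Qed.

Lemma bounded_labels_finite N : exists U : {fset label V},
  forall s, (size s.2 <= N)%N -> s \in U.
Proof.
exists [fset ((a.1, bseqval a.2) : label V) | a in {: V * {bseq N of V}}]%fset.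
move=> [i l] /= lN; apply/imfsetP => /=.
by exists (i, Bseq lN).
Qed.

End NodeSequences.

(** * Charging *)

Section Charging.

Import numFieldNormedType.Exports.

Variables (R : realType) (V : finType) (I : instance R V).
Implicit Types (b t : R) (i j : V) (l : seq V) (p : label V).

Lemma charging_ivt t u b : 0 <= t -> t <= u ->
  charging I t <= b <= charging I u ->
  exists2 c, t <= c <= u & charging I c = b.
Proof.
move=> t0 tu tbu.
have [||c] := @IVT R (charging I) t u b tu.
- apply: continuous_subspaceW (@charging_continuous _ _ I) => c /=.
  by rewrite in_itv /= => /andP[+ _]; apply: le_trans.
- have le_tu := charging_nondecreasing I t0 tu.
  by rewrite (min_idPl le_tu) (max_idPr le_tu).
by rewrite in_itv => ctu gc; exists c.
Qed.

Lemma charge_inv_spec b : in_battery I b ->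
  [/\ 0 <= charge_inv I b, charging I (charge_inv I b) = b
    & forall t, 0 <= t -> charging I t = b -> charge_inv I b <= t].
Proof.
move=> /andP[b0 bB].
pose A : set R := [set t : R | 0 <= t /\ charging I t = b]%classic.
have [T T0 gT] := charging_full I.
have [|c /andP[c0 cT] gc] := @charging_ivt 0 T b (lexx _) T0.
  by rewrite charging0 b0 gT.
have An0 : (A !=set0)%classic by exists c.
have lbA0 : lbound A 0 by move=> t [].
have lbA : has_lbound A by exists 0.
have inf0 : 0 <= inf A by exact: lb_le_inf.
have inf_le t : A t -> inf A <= t by move=> At; apply: ge_inf.
(* if the charge at the infimum m were below b, then some c > m would have a
   charge strictly in between, and c would be a lower bound of A *)
have g_inf : charging I (inf A) = b.
  have := charging_nondecreasing I inf0 (inf_le _ (conj c0 gc)).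
  rewrite gc le_eqVlt => /orP[/eqP //|lt_b].
  have [|v /andP[mv vc] gv] := @charging_ivt (inf A) c
    ((charging I (inf A) + b) / 2) inf0 (inf_le _ (conj c0 gc)).
    by rewrite gc; lra.
  have : v <= inf A.
    apply: lb_le_inf => // t [t0 gt]; rewrite leNgt; apply/negP => tv.
    have := charging_nondecreasing I t0 (ltW tv); rewrite gv gt; lra.
  move=> vm; have Ev : v = inf A by apply/eqP; rewrite eq_le vm mv.
  by move: gv; rewrite Ev; lra.
have [[ge0 ginv] lb] : (A `&` lbound A)%classic (charge_inv I b).
  by apply: xgetPex; exists (inf A); split.
by split=> // t t0 gt; apply: lb.
Qed.

Lemma charge_inv_le b1 b2 : in_battery I b1 -> in_battery I b2 ->
  b1 <= b2 -> charge_inv I b1 <= charge_inv I b2.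
Proof.
move=> b1B b2B b12; rewrite leNgt; apply/negP => lt21.
have [ge1 g1 _] := charge_inv_spec b1B; have [ge2 g2 _] := charge_inv_spec b2B.
have := charging_nondecreasing I ge2 (ltW lt21); rewrite g1 g2 => b21.
have Eb : b1 = b2 by apply/eqP; rewrite eq_le b12.
by rewrite Eb ltxx in lt21.
Qed.

Lemma charge_from_in_battery b t : in_battery I b -> 0 <= t ->
  in_battery I (charge_from I b t).
Proof.
by move=> /charge_inv_spec[ge0 _ _] t0; apply: charging_range; rewrite addr_ge0.
Qed.

Lemma charge_from_le b1 b2 t1 t2 : in_battery I b1 -> in_battery I b2 ->
  b1 <= b2 -> 0 <= t1 -> t1 <= t2 ->
  charge_from I b1 t1 <= charge_from I b2 t2.
Proof.
move=> b1B b2B b12 t10 t12; apply: charging_nondecreasing.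
  by have [ge0 _ _] := charge_inv_spec b1B; rewrite addr_ge0.
by rewrite lerD // charge_inv_le.
Qed.

(** Charging twice in a row is no better than charging once for the total
    time; the two may differ only in that the second charge is calibrated on
    the first time at which the battery level is attained. *)
Lemma charge_from_twice b t1 t2 : in_battery I b -> 0 <= t1 -> 0 <= t2 ->
  charge_from I (charge_from I b t1) t2 <= charge_from I b (t1 + t2).
Proof.
move=> bB t10 t20; have [ge0 _ _] := charge_inv_spec bB.
have [ge1 _ least1] := charge_inv_spec (charge_from_in_battery bB t10).
apply: charging_nondecreasing; first by rewrite addr_ge0.
by rewrite addrA lerD // least1 // addr_ge0.
Qed.

(** * Cutting paths into legs *)

Lemma path_state_timeS tau p k : (path_state I tau p k.+1).1 =
  Num.max ((path_state I tau p k).1 + tau k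
             + travel_time I (node p k) (node p k.+1)) (tw_open I (node p k.+1)).
Proof. by rewrite /=; case: path_state. Qed.

Lemma path_state_batteryS tau p k : (path_state I tau p k.+1).2 =
  (if node p k \in stations I then charge_from I (path_state I tau p k).2 (tau k)
   else (path_state I tau p k).2) - battery_use I (node p k) (node p k.+1).
Proof. by rewrite /=; case: path_state. Qed.

Lemma subpath_state_timeS t b p k : (subpath_state I t b p k.+1).1 =
  Num.max ((subpath_state I t b p k).1 + travel_time I (node p k) (node p k.+1))
    (tw_open I (node p k.+1)).
Proof. by rewrite /=; case: subpath_state. Qed.

Lemma subpath_state_batteryS t b p k : (subpath_state I t b p k.+1).2 =
  (subpath_state I t b p k).2 - battery_use I (node p k) (node p k.+1).
Proof. by rewrite /=; case: subpath_state. Qed.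

Lemma customer_not_station i : i \in customers I -> i \notin stations I.
Proof. by move=> ci; rewrite (disjointFr (customers_stations_disjoint I) ci). Qed.

Lemma customer_not_facility i :
  i \in customers I -> i \notin depots I :|: stations I.
Proof.
move=> ci; rewrite inE (negbTE (customer_not_station ci)) orbF.
by rewrite (disjointFr (customers_depots_disjoint I) ci).
Qed.

Lemma facility_not_customer i :
  (i \notin customers I) = (i \in depots I :|: stations I).
Proof.
apply/idP/idP => [nc|].
  have : i \in [set: V]%SET by rewrite inE.
  by rewrite -(nodes_cover I) -finset.setUA inE (negbTE nc).
by apply: contraL; apply: customer_not_facility.
Qed.

Lemma facility_window i t : i \in depots I :|: stations I ->
  in_window I i t = (0 <= t <= horizon I).
Proof. by move=> /(tw_facility (i := i))[_]; rewrite /in_window => -> ->. Qed.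

(** A leg of a feasible path between two facilities is a feasible subpath: it
    starts at the time and with the battery level at which the path leaves the
    first of these. *)
Lemma feasible_subpath_leg i l1 l2 : feasible_path I (i, l1 ++ l2) ->
  l2 != [::] -> partial_subpath I (last i l1, l2) ->
  feasible_subpath I (last i l1, l2).
Proof.
move=> [/and3P[arcs _ _] dem [tau run]] l20 part; split=> //.
  exact/(le_trans (total_demand_suffix _ _ _ _))/dem.
set p := (i, l1 ++ l2) in arcs dem run *; set s := (_, l2) in part *.
pose m := size l1; pose st k := path_state I tau p k.
have nodeE k : (k <= size l2)%N -> node p (m + k) = node s k.
  exact: node_catr.
have size_p : size p.2 = (m + size l2)%N by rewrite size_cat.
have lt0 : (0 < size l2)%N by case: (l2) l20.
have mE : node p m = node s 0 by rewrite -[m]addn0 nodeE.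
have fac : node s 0 \in depots I :|: stations I by case/and3P: part.
have run_m : (m <= size p.2)%N by rewrite size_p leq_addr.
have run_k k : (k <= size l2)%N -> (m + k <= size p.2)%N.
  by rewrite size_p leq_add2l.
have [tau0 _ bat_m win_m] := run m run_m.
pose t0 := (st m).1 + tau m.
pose b0 := if node p m \in stations I then charge_from I (st m).2 (tau m)
           else (st m).2.
have stE k : (0 < k <= size l2)%N -> subpath_state I t0 b0 s k = st (m + k)%N.
  elim: k => // k IH /andP[_ kl].
  rewrite [LHS]surjective_pairing [RHS]surjective_pairing /st addnS.
  rewrite subpath_state_timeS subpath_state_batteryS.
  rewrite path_state_timeS path_state_batteryS -addnS !nodeE ?(ltnW kl) //.
  case: k IH kl => [_ _|k IH kl]; first by rewrite addn0 /= /t0 /b0 mE.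
  have cust : node s k.+1 \in customers I.
    by case/and3P: part => _ _ /mem_inner_nodes; apply; rewrite kl.
  have nsta := customer_not_station cust.
  have [_ tau_k _ _] := run _ (run_k _ (ltnW kl)).
  rewrite nodeE ?(ltnW kl) // in tau_k.
  by rewrite (negbTE nsta) tau_k // addr0 IH //= (ltnW kl).
exists t0, b0; case=> [_|k kl]; last first.
  rewrite stE // -nodeE //.
  by have [_ _] := run _ (run_k _ kl).
split.
  by rewrite /= /b0; case: ifP => // _; apply: charge_from_in_battery.
rewrite /= (facility_window _ fac).
have [open0 _ _] := tw_within_horizon I (node p m).
have m0 : 0 <= (st m).1 by case/andP: win_m => [+ _]; apply: le_trans.
rewrite addr_ge0 //=.
have [_ _ _ /andP[_]] := run _ (run_k _ lt0).
have [_ _ leT] := tw_within_horizon I (node p (m + 1)).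
move=> /le_trans/(_ leT); apply: le_trans; rewrite addn1 path_state_timeS.
rewrite le_max lerDl ltW //; apply: travel_time_gt0.
by apply: node_arc arcs _; rewrite size_p -addn1 leq_add2l.
Qed.

(** A loop through customers at a station can be cut out of a feasible path.
    Charging at once for the sum of the two charging times lets the vehicle
    leave the station no later, and with at least as much battery. *)
Lemma feasible_path_cut i l1 l2 l3 : feasible_path I (i, l1 ++ l2 ++ l3) ->
  l2 != [::] -> l3 != [::] ->
  last i l1 \in stations I -> last (last i l1) l2 = last i l1 ->
  all [in customers I] (inner_nodes (last i l1, l2)) ->
  feasible_path I (i, l1 ++ l3).
Proof.
move=> [/and3P[arcs fi inner] dem [tau run]] l20 l30 sta loop cust; split.
- apply/and3P; split=> //=.
    by move: arcs; rewrite /= !cat_path loop => /and3P[-> _ ->].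
  move: inner; rewrite catA !inner_nodes_cat // last_cat loop !all_cat.
  by rewrite -andbA => /and3P[-> _ ->].
- apply: le_trans dem; rewrite !total_demand_cat lerD2l big_cat /=.
  by rewrite lerDr sum_demand_ge0.
set p := (i, l1 ++ l2 ++ l3) in arcs fi inner dem run *; set p' := (i, l1 ++ l3).
pose m := size l1; pose d := size l2; pose n := (m + d)%N.
pose st k := path_state I tau p k.
(* [m] and [n] are the positions of the two visits to the station *)
pose tau' k := if (k < m)%N then tau k else
               if k == m then tau m + tau n else tau (k + d)%N.
have d0 : (0 < d)%N by rewrite /d; case: (l2) l20.
have size_p : size p.2 = (n + size l3)%N by rewrite !size_cat addnA.
have size_p' : size p'.2 = (m + size l3)%N by rewrite size_cat.
have nodeL k : (k <= m)%N -> node p' k = node p k by move=> km; rewrite !node_catl.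
have nodeR k : (k <= size l3)%N -> node p' (m + k) = node p (n + k).
  move=> kl; rewrite node_catr // /p catA /n /m /d -size_cat node_catr //.
  by rewrite last_cat loop.
have node_m : node p m = last i l1 by rewrite /p node_catl // node_last.
have node_n : node p n = node p m by rewrite -[n]addn0 -nodeR // addn0 nodeL.
have loop_inner k : (0 < k < d)%N -> node p (m + k) \notin stations I.
  move=> /andP[k0 kd]; rewrite /p node_catr; last first.
    by rewrite size_cat (leq_trans (ltnW kd)) // leq_addr.
  rewrite node_catl ?(ltnW kd) //; apply: customer_not_station.
  by apply: (mem_inner_nodes cust); rewrite k0.
have runS k : (k <= n + size l3)%N ->
    [/\ 0 <= tau k, node p k \notin stations I -> tau k = 0,
        in_battery I (st k).2 & in_window I (node p k) (st k).1].
  by rewrite -size_p; apply: run.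
have arc_p k : (k < n + size l3)%N -> is_arc I (node p k) (node p k.+1).
  by rewrite -size_p; apply: node_arc arcs.
have mn : (m + d <= n + size l3)%N by rewrite leq_addr.
have m_le : (m <= n + size l3)%N by rewrite (leq_trans _ mn) ?leq_addr.
have n_le : (n <= n + size l3)%N by rewrite leq_addr.
have [taum0 _ batm _] := runS m m_le; have [taun0 _ batn _] := runS n n_le.
have stateL k : (k <= m)%N -> path_state I tau' p' k = st k.
  elim: k => // k IH km; rewrite /st /= -/(st k) IH ?(ltnW km) //.
  by rewrite !nodeL ?(ltnW km) // /tau' km.
(* around the loop, the vehicle only gets later and loses battery *)
have in_loop k : (0 < k <= d)%N -> (st m).1 + tau m <= (st (m + k)%N).1
     /\ (st (m + k)%N).2 <= charge_from I (st m).2 (tau m).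
  elim: k => // k IH /andP[_ kd]; have mk : (m + k < n + size l3)%N.
    by rewrite (leq_trans _ mn) // ltn_add2l.
  have tt0 := travel_time_gt0 (arc_p _ mk).
  have bb0 := battery_use_gt0 (arc_p _ mk).
  rewrite addnS /st path_state_timeS path_state_batteryS -!/(st _) le_max.
  case: k IH kd mk tt0 bb0 => [|k] IH kd mk tt0 bb0.
    rewrite addn0 node_m sta in tt0 bb0 *.
    by rewrite lerDl ltW //= lerBlDr lerDl ltW.
  rewrite (negbTE (loop_inner k.+1 _)) //.
  have [le1 le2] := IH (ltnW kd); have [tk0 _ _ _] := runS _ (ltnW mk).
  split.
    apply/orP; left.
    by rewrite -addrA (le_trans le1) // lerDl addr_ge0 // ltW.
  by rewrite lerBlDr (le_trans le2) // lerDl ltW.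
have [time_n bat_n] : (st m).1 + tau m <= (st n).1
     /\ (st n).2 <= charge_from I (st m).2 (tau m).
  by apply: in_loop; rewrite d0 leqnn.
have tau'_m : tau' m = tau m + tau n by rewrite /tau' ltnn eqxx.
have tau'_R k : tau' (m + k.+1)%N = tau (n + k.+1)%N.
  rewrite /tau' ltnNge leq_addr /= -{2}[m]addn0 eqn_add2l /=.
  by rewrite addnAC.
pose st' := path_state I tau' p'.
pose chg k := if node p k \in stations I then charge_from I (st k).2 (tau k)
              else (st k).2.
pose chg' k := if node p' k \in stations I then charge_from I (st' k).2 (tau' k)
               else (st' k).2.
have arrive k : (k < size l3)%N ->
    (st' (m + k)%N).1 + tau' (m + k)%N <= (st (n + k)%N).1 + tau (n + k)%N ->
    chg (n + k)%N <= chg' (m + k)%N <= battery_cap I ->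
    [/\ (st' (m + k.+1)%N).1 <= (st (n + k.+1)%N).1,
        (st (n + k.+1)%N).2 <= (st' (m + k.+1)%N).2
      & in_battery I (st' (m + k.+1)%N).2].
  move=> kl le_t /andP[le_b le_B].
  have nk : (n + k < n + size l3)%N by rewrite ltn_add2l.
  have bb0 := battery_use_gt0 (arc_p _ nk).
  have [_ _ /andP[bn1 _] _] := runS (n + k).+1 nk.
  have nodeS : node p' (m + k).+1 = node p (n + k).+1 by rewrite -!addnS nodeR.
  rewrite !addnS /st' /st !path_state_timeS !path_state_batteryS in bn1 *.
  rewrite -/(chg _) -/(chg' _) -!/(st _) -!/(st' _) in bn1 *.
  rewrite nodeS (nodeR _ (ltnW kl)); split.
  - by rewrite ge_max !le_max lexx orbT andbT lerD2r le_t.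
  - by rewrite lerD2r.
  - apply/andP; split; first by rewrite (le_trans bn1) // lerD2r.
    by rewrite lerBlDr (le_trans le_B) // lerDl ltW.
(* on the rest of the path, the shortened path runs no later and with no less
   battery *)
have stateR k : (k < size l3)%N ->
    [/\ (st' (m + k.+1)%N).1 <= (st (n + k.+1)%N).1,
        (st (n + k.+1)%N).2 <= (st' (m + k.+1)%N).2
      & in_battery I (st' (m + k.+1)%N).2].
  elim: k => [|k IH] kl; apply: arrive => //.
  - by rewrite !addn0 tau'_m /st' stateL // addrA lerD2r.
  - rewrite !addn0 /chg /chg' node_n nodeL // node_m sta /st' stateL // tau'_m.
    have [_ ->] := andP (charge_from_in_battery batm (addr_ge0 taum0 taun0)).
    rewrite andbT (le_trans _ (charge_from_twice batm taum0 taun0)) //.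
    by apply: charge_from_le => //; apply: charge_from_in_battery.
  - have [le_t _ _] := IH (ltnW kl).
    by rewrite tau'_R lerD2r.
  - have [_ le_b bat'] := IH (ltnW kl).
    have [tk0 _ batk _] := runS (n + k.+1)%N (leq_add (leqnn n) (ltnW kl)).
    rewrite /chg /chg' nodeR ?(ltnW kl) // tau'_R; case: ifP => _.
      have [_ ->] := andP (charge_from_in_battery bat' tk0).
      by rewrite andbT; apply: charge_from_le.
    by rewrite le_b; case/andP: bat'.
exists tau' => k; rewrite size_p' => kl.
have [km|mk] := leqP k m.
  have [tk0 tkN batk wink] := runS k (leq_trans km m_le).
  rewrite nodeL // stateL //; split=> //; rewrite /tau'.
    by case: ltngtP km => // _ _; rewrite addr_ge0.
  move: tkN; case: ltngtP km => // -> _.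
  by rewrite node_m sta.
have [k0 Ek] : exists k0, k = (m + k0.+1)%N.
  by exists (k - m.+1)%N; rewrite -addSnnS subnKC.
have k0l : (k0 < size l3)%N by move: kl; rewrite Ek leq_add2l.
rewrite Ek {k Ek mk kl}.
have [tk0 tkN _ wink] := runS (n + k0.+1)%N (leq_add (leqnn n) k0l).
have [le_t _ batk'] := stateR _ k0l.
rewrite nodeR // tau'_R; split=> //.
case/andP: wink => _ /(le_trans le_t) close'; apply/andP; split=> //.
by rewrite -nodeR // addnS path_state_timeS le_max lexx orbT.
Qed.

End Charging.

(** * Reduced costs of complete paths *)

Section PathReducedCost.

Variables (R : realType) (V : finType) (I : instance R V).
Implicit Types (i j : V) (l : seq V) (f : V -> R).

Lemma sum_arc_tails f i l :
  \sum_(a <- arcs_of (i, l)) f a.1 = \sum_(j <- belast i l) f j.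
Proof.
rewrite /arcs_of /nodes /=.
by elim: l i => [|j l IH] i /=; rewrite ?big_nil // !big_cons IH.
Qed.

Lemma sum_arc_heads f i l :
  \sum_(a <- arcs_of (i, l)) f a.2 = \sum_(j <- l) f j.
Proof.
rewrite /arcs_of /nodes /=.
by elim: l i => [|j l IH] i /=; rewrite ?big_nil // !big_cons IH.
Qed.

Lemma sum_count_mem (A : {set V}) f l :
  \sum_(i in A) (count_mem i l)%:R * f i = \sum_(j <- l) (j \in A)%:R * f j.
Proof.
elim: l => [|j l IH]; first by rewrite big_nil big1 // => i _; rewrite mul0r.
rewrite big_cons -IH /=; under eq_bigr => i _ do rewrite natrD mulrDl.
rewrite big_split /=; congr (_ + _).
under eq_bigr => i _ do rewrite mulr_natl mulrb.
rewrite -big_mkcondr /= mulr_natl mulrb.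
have [jA|jA] := boolP (j \in A).
  by rewrite (big_pred1 j) // => i /=; case: eqVneq => [<-|]; rewrite ?jA ?andbF.
by rewrite big_pred0 // => i; case: eqVneq => [<-|]; rewrite ?(negbTE jA) ?andbF.
Qed.

Lemma path_reduced_costE kappa mu nu p : complete_path I p ->
  path_reduced_cost I kappa mu nu p = reduced_cost I kappa mu nu p.
Proof.
case: p => i l /and3P[/and3P[_ /= iD inner]].
case/lastP: l inner => // l j; rewrite -{1}cats1 inner_nodes_cat // cats0.
move=> /allP inner _ jD; rewrite /last_node /= last_rcons in jD.
have notD k : k \in l -> k \notin depots I.
  move=> /inner; rewrite inE => /orP[kC|kS].
    by rewrite (disjointFr (customers_depots_disjoint I) kC).
  by rewrite (disjointFl (depots_stations_disjoint I) kS).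
have iC : i \notin customers I.
  by rewrite (disjointFl (customers_depots_disjoint I) iD).
rewrite /path_reduced_cost sum_count_mem /reduced_cost /arc_reduced_cost.
rewrite !sumrB /last_node /=.
rewrite (sum_arc_tails (fun k => (k \in depots I)%:R * kappa k)).
rewrite (sum_arc_heads (fun k => (k \in depots I)%:R * mu k)).
rewrite (sum_arc_heads (fun k => (k \in customers I)%:R * nu k)).
rewrite big_cons (negbTE iC) mul0r add0r.
congr (_ - _ - _ - _).
  rewrite belast_rcons big_cons iD mul1r big1_seq ?addr0 // => k /= /notD.
  by move=> /negbTE->; rewrite mul0r.
rewrite last_rcons -cats1 big_cat big_seq1 /= jD mul1r big1_seq ?add0r //.
by move=> k /= /notD/negbTE->; rewrite mul0r.
Qed.

End PathReducedCost.

(** * First phase *)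

Lemma mem_single_nodes (V : finType) (A : {set V}) (s : label V) :
  (s \in [fset x in [seq (i, [::]) | i in A]]%fset) = (s.1 \in A) && (s.2 == [::]).
Proof.
rewrite in_fset -[LHS]/(s \in [seq (i, [::]) | i in A]).
apply/mapP/andP => [[i iA ->]|]; first by rewrite -mem_enum eqxx.
by case: s => i l [/= iA /eqP->]; exists i; rewrite ?mem_enum.
Qed.

Section Domination.

Variables (R : realType) (V : finType) (K : Type) (res : K -> label V -> R).

Lemma dominates_refl s : dominates res s s.
Proof. by split. Qed.

Lemma dominates_trans s1 s2 s3 :
  dominates res s1 s2 -> dominates res s2 s3 -> dominates res s1 s3.
Proof.
move=> [f12 l12 r12] [f23 l23 r23]; split=> [||k]; first by rewrite f12.
  by rewrite l12.
exact: le_trans (r23 k).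
Qed.

End Domination.

Section FirstPhase.

Variables (R : realType) (V : finType) (I : instance R V).
Variables (kappa mu nu : V -> R) (K : Type) (res : K -> label V -> R).
Implicit Types (i j : V) (l : seq V) (s : label V).

Hypothesis domination_i : forall s1 s2 a,
  feasible_subpath I s1 -> feasible_subpath I s2 -> dominates res s1 s2 ->
  arc_extends I s1 a -> arc_extends I s2 a ->
  feasible_subpath I (add_arc s2 a) ->
  feasible_subpath I (add_arc s1 a) /\
  dominates res (add_arc s1 a) (add_arc s2 a).
Hypothesis cost_resource : exists k, forall s,
  feasible_subpath I s -> res k s = reduced_cost I kappa mu nu s.
Hypothesis increasing_resource : exists k, forall s a,
  feasible_subpath I s -> arc_extends I s a ->
  feasible_subpath I (add_arc s a) -> res k s < res k (add_arc s a).

Local Notation search1 := (find_nondominated_subpaths I res).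

Lemma reached_subpath s : reached search1 s -> s.2 = [::] \/ feasible_subpath I s.
Proof.
case=> [x|x e _ _ fx]; last by right.
by rewrite mem_single_nodes => /andP[_ /eqP]; left.
Qed.

Lemma find_subpaths_terminates : terminates search1.
Proof.
have [N sizeN] := feasible_size_bounded I.
have [U memU] := bounded_labels_finite V N.
apply: (@search_terminates _ _ _ search1 (dominates_refl res)
  (@dominates_trans _ _ _ res) U) => s /reached_subpath[s0|fs];
  apply: memU; first by rewrite s0.
by apply: sizeN; left.
Qed.

Lemma arc_extends_last i l j : partial_subpath I (i, rcons l j) ->
  arc_extends I (i, l) (last i l, j).
Proof.
move=> part; apply/and3P; split=> //=.
by case/and3P: part; rewrite /= rcons_path => /andP[].
Qed.

Lemma subpath_start_lt : exists k, forall i l, l != [::] ->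
  feasible_subpath I (i, l) -> res k (i, [::]) < res k (i, l).
Proof.
have [k incr] := increasing_resource; exists k => i.
elim/last_ind => // l j IH _ fl.
have ext : arc_extends I (i, l) (last i l, j).
  by case: fl => part _ _; apply: arc_extends_last.
have fl' : feasible_subpath I (i, l).
  by rewrite -cats1 in fl; apply: feasible_subpath_prefix fl.
have lt_l := incr _ _ fl' ext fl.
have [E|l0] := eqVneq l [::]; first by rewrite -{1}E.
exact: lt_trans (IH l0 fl') lt_l.
Qed.

(** A label dominating one that can be extended can be extended likewise: it
    cannot be complete, even if the dominated label is a single node. *)
Lemma dominating_extends s i l j :
  feasible_subpath I s -> dominates res s (i, l) ->
  feasible_subpath I (i, rcons l j) ->
  arc_extends I s (last i l, j) /\ ~~ complete_subpath I s.
Proof.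
move=> fs [Ei El le_res] flj.
have [part _ _] := flj; have ext := arc_extends_last part.
have last_s : s.2 == [::] \/ last_node s \in customers I.
  rewrite El /last_node /=; have [l0|l0] := eqVneq l [::]; last first.
    right; case/and3P: part => _ _; rewrite -cats1 => inner.
    exact: (last_inner_node inner).
  left; apply: contraT => s0; have [k lt_k] := subpath_start_lt.
  case: s fs Ei El le_res s0 => i' l' /= fs Ei El le_res s0.
  move: (lt_k _ _ s0 fs); rewrite ltNge; case/negP.
  by move: (le_res k); rewrite l0 /first_node /= in Ei *; rewrite -Ei.
have ncs : ~~ complete_subpath I s.
  case: last_s => [/eqP s0|cust]; rewrite /complete_subpath.
    by rewrite s0 eqxx andbF.
  by rewrite (negbTE (customer_not_facility cust)) !andbF.
split=> //; case/and3P: ext => arc _ _.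
have [/and3P[arcs fac inner] _ _] := fs.
rewrite /arc_extends /= arc El eqxx /=; apply/and3P; split=> //=.
  by rewrite rcons_path arcs -[last s.1 s.2]/(last_node s) El.
case: s last_s inner {fs Ei El le_res ncs arcs fac} => i' l' /= last_s inner.
rewrite /add_arc -cats1 /= inner_nodes_cat // cats0.
case: last_s => [/eqP->//|].
case/lastP: l' inner => // l' k; rewrite -{1}cats1 inner_nodes_cat // cats0.
by rewrite /last_node /= last_rcons all_rcons => -> ->.
Qed.

(** The subpaths returned by the first phase dominate every feasible subpath,
    except the loops that a vehicle does better to skip: a loop of nonnegative
    reduced cost may be dominated by its first node alone, which is not a
    complete subpath. *)
Lemma find_subpaths_dominating S : returns search1 S ->
  (forall s, s \in S -> feasible_subpath I s /\ complete_subpath I s) /\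
  (forall s, feasible_subpath I s -> complete_subpath I s ->
     first_node s != last_node s \/ reduced_cost I kappa mu nu s < 0 ->
     exists2 x, x \in S & dominates res x s).
Proof.
move=> /(@returns_exhaustive _ _ _ search1 (dominates_refl res)
  (@dominates_trans _ _ _ res)).
move=> [G [-> reachG initG closedG]].
have feasG x s : x \in G -> dominates res x s -> feasible_subpath I s ->
    feasible_subpath I x.
  case: x s => i l [i' l'] /reachG/reached_subpath[/= ->|//].
  by move=> [/= -> _ _] /(feasible_subpath_prefix (l1 := [::])).
have dom i l : feasible_subpath I (i, l) -> exists2 x, x \in G &
    feasible_subpath I x /\ dominates res x (i, l).
  elim/last_ind: l => [|l j IH] fl.
    have [|x xG dx] := initG (i, [::]).
      by rewrite mem_single_nodes eqxx andbT; case: fl => /and3P[].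
    by exists x => //; split=> //; apply: feasG dx fl.
  have fl' : feasible_subpath I (i, l).
    by rewrite -cats1 in fl; apply: feasible_subpath_prefix fl.
  have [x xG [fx dx]] := IH fl'.
  have [ext_x ncx] := dominating_extends fx dx fl.
  have ext : arc_extends I (i, l) (last i l, j).
    by case: fl => part _ _; apply: arc_extends_last.
  have [fxa dxa] := domination_i fx fl' dx ext_x ext fl.
  have [|y yG dy] := closedG _ (last i l, j) xG ncx _ fxa.
    by rewrite /= mem_enum.
  have dyl := dominates_trans dy dxa.
  by exists y => //; split=> //; apply: feasG dyl fl.
split=> [s|[i l] fs cs notloop].
  rewrite !inE /= => /andP[/reachG/reached_subpath[s0|//] cs].
  by case/and3P: cs; rewrite s0.
have [x xG [fx dx]] := dom _ _ fs; exists x => //.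
rewrite !inE xG /=; have [part _ _] := fx; apply/and3P; split=> //; last first.
  by have [_ -> _] := dx; case/and3P: cs.
apply/negP => /eqP x0; case: dx => first_x last_x le_x.
case: notloop => [|]; first by rewrite -first_x -last_x /last_node x0 eqxx.
have [k cost] := cost_resource; rewrite -cost // => lt0.
move: (le_lt_trans (le_x k) lt0); rewrite cost //.
by case: (x) x0 => i' l' /= ->; rewrite reduced_cost_nil ltxx.
Qed.

End FirstPhase.

(** * Second phase *)

Section SecondPhase.

Variables (R : realType) (V : finType) (I : instance R V).
Variables (kappa mu nu : V -> R).
Variables (Ks : Type) (res_s : Ks -> label V -> R).
Variables (Kp : Type) (res_p : Kp -> label V -> R) (S : {fset label V}).
Implicit Types (i j : V) (l : seq V) (p s : label V).

Hypothesis domination_ii : forall p1 p2 s,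
  feasible_path I p1 -> feasible_path I p2 -> dominates res_p p1 p2 ->
  subpath_extends I p1 s -> subpath_extends I p2 s ->
  feasible_path I (add_subpath p2 s) ->
  feasible_path I (add_subpath p1 s) /\
  dominates res_p (add_subpath p1 s) (add_subpath p2 s).
Hypothesis domination_iii : forall s1 s2 p,
  feasible_subpath I s1 -> complete_subpath I s1 ->
  feasible_subpath I s2 -> complete_subpath I s2 ->
  dominates res_s s1 s2 -> feasible_path I p ->
  subpath_extends I p s1 -> subpath_extends I p s2 ->
  feasible_path I (add_subpath p s2) ->
  feasible_path I (add_subpath p s1) /\
  dominates res_p (add_subpath p s1) (add_subpath p s2).
Hypothesis cost_resource : exists k, forall p,
  feasible_path_label I p -> res_p k p = reduced_cost I kappa mu nu p.
Hypothesis increasing_resource : exists k, forall p s,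
  feasible_path_label I p -> subpath_extends I p s ->
  feasible_path I (add_subpath p s) -> res_p k p < res_p k (add_subpath p s).
Hypothesis subpaths_feasible : forall s, s \in S ->
  feasible_subpath I s /\ complete_subpath I s.
Hypothesis subpaths_dominating : forall s,
  feasible_subpath I s -> complete_subpath I s ->
  first_node s != last_node s \/ reduced_cost I kappa mu nu s < 0 ->
  exists2 x, x \in S & dominates res_s x s.

Local Notation search2 := (find_nondominated_paths I res_p S).

(** The paths that the pricing problem asks for. *)
Definition negative_path p : Prop := [/\ complete_path I p, feasible_path I p
  & path_reduced_cost I kappa mu nu p < 0].

Lemma reached_path p : reached search2 p -> p.2 = [::] \/ feasible_path I p.
Proof.
case=> [x|x e _ _ fx]; last by right.
by rewrite mem_single_nodes => /andP[_ /eqP]; left.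
Qed.

Lemma reached_path_facility p :
  reached search2 p -> last_node p \notin customers I.
Proof.
case=> [x|[i l] e _]; rewrite /= facility_not_customer.
  by case: x => i l; rewrite mem_single_nodes => /andP[iD /eqP/= ->]; rewrite inE iD.
rewrite mem_filter => /andP[+ _] _; case/and3P=> /and3P[_ _ fac] /eqP Ee _.
by rewrite /last_node /add_subpath /= last_cat -[last i l]/(last_node (i, l)) Ee.
Qed.

Lemma reached_path_start_lt : exists k, forall p, reached search2 p ->
  p.2 != [::] -> res_p k (p.1, [::]) < res_p k p.
Proof.
have [k incr] := increasing_resource; exists k => p.
elim=> [x|[i l] e reach_x IH ext fx _].
  by rewrite mem_single_nodes => /andP[_ ->].
have ext' : subpath_extends I (i, l) e.
  by move: ext; rewrite mem_filter => /andP[].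
have fl : feasible_path_label I (i, l).
  by split; [apply: feasible_path_prefix fx | apply: reached_path_facility].
have lt_e := incr _ _ fl ext' fx.
have [l0|l0] := eqVneq l [::]; last exact: lt_trans (IH l0) lt_e.
by rewrite /= -{1}l0.
Qed.

Lemma find_paths_terminates : terminates search2.
Proof.
have [N sizeN] := feasible_size_bounded I.
have [U memU] := bounded_labels_finite V N.
apply: (@search_terminates _ _ _ search2 (dominates_refl res_p)
  (@dominates_trans _ _ _ res_p) U) => s /reached_path[s0|fs];
  apply: memU; first by rewrite s0.
by apply: sizeN; right.
Qed.

Lemma find_paths_sound P p : returns search2 P -> p \in P ->
  path_reduced_cost I kappa mu nu p < 0 -> negative_path p.
Proof.
move=> /(@returns_exhaustive _ _ _ search2 (dominates_refl res_p)
  (@dominates_trans _ _ _ res_p)).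
move=> [G [-> reachG _ _]]; rewrite !inE /= => /andP[pG cp] lt0; split=> //.
have [p0|//] := reached_path (reachG _ pG).
by case/and3P: cp; rewrite p0.
Qed.

Lemma shortest_negative_path : (exists p, negative_path p) ->
  exists2 p, negative_path p &
    forall p', negative_path p' -> (size p.2 <= size p'.2)%N.
Proof.
move=> [p neg]; pose has_size n := `[< exists2 p, negative_path p & size p.2 = n >].
have ex_size : exists n, has_size n by exists (size p.2); apply/asboolP; exists p.
case: (ex_minnP ex_size) => n /asboolP[p' neg' <-] min; exists p' => // q negq.
by apply: min; apply/asboolP; exists q.
Qed.

Lemma negative_pathE p : complete_path I p -> feasible_path I p ->
  reduced_cost I kappa mu nu p < 0 -> negative_path p.
Proof. by move=> cp fp lt0; split=> //; rewrite path_reduced_costE. Qed.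

Lemma inner_path_station i l1 l2 : partial_path I (i, l1 ++ l2) ->
  l1 != [::] -> l2 != [::] -> last i l1 \notin customers I ->
  last i l1 \in stations I.
Proof.
case/and3P=> _ _ inner l10 l20 nc.
by have := last_inner_node inner l10 l20; rewrite /= inE (negbTE nc).
Qed.

(** On a shortest negative path no leg is a loop of nonnegative reduced cost,
    for that loop could be cut out. *)
Lemma shortest_negative_leg i l1 l2 l3 :
  negative_path (i, l1 ++ l2 ++ l3) ->
  (forall p', negative_path p' -> (size (l1 ++ l2 ++ l3) <= size p'.2)%N) ->
  l2 != [::] -> last (last i l1) l2 \notin customers I ->
  all [in customers I] (inner_nodes (last i l1, l2)) ->
  last i l1 != last (last i l1) l2 \/
  reduced_cost I kappa mu nu (last i l1, l2) < 0.
Proof.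
move=> [cp fp +] min l20 nc cust; rewrite path_reduced_costE //.
have [loop lt0|] := eqVneq (last i l1) (last (last i l1) l2); last by left.
have [part _ _] := fp; right; rewrite ltNge; apply/negP => ge0.
have [/and3P[_ iD _] _ lastD] := and3P cp.
have neq_ds : forall j, j \in depots I -> j \in stations I -> False.
  by move=> j jD; rewrite (disjointFr (depots_stations_disjoint I) jD).
have [E|l30] := eqVneq l3 [::].
  rewrite E cats0 in lt0 part lastD *.
  have [E1|l10] := eqVneq l1 [::].
    by move: lt0 ge0; rewrite E1 /= ltNge => /negP.
  apply: (neq_ds (last i l1)).
    by rewrite loop -last_cat.
  by apply: inner_path_station part _ _ _; rewrite // loop.
have sta : last i l1 \in stations I.
  rewrite loop -last_cat; apply: (inner_path_station (l2 := l3)) => //.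
  - by rewrite -catA.
  - by rewrite -size_eq0 size_cat addn_eq0 negb_and !size_eq0 l20 orbT.
  - by rewrite last_cat.
have fp' := feasible_path_cut fp l20 l30 sta (esym loop) cust.
have neg' : negative_path (i, l1 ++ l3).
  apply: negative_pathE => //.
    have [part' _ _] := fp'; apply/and3P; split=> //=.
      by rewrite -size_eq0 size_cat addn_eq0 negb_and !size_eq0 l30 orbT.
    by move: lastD; rewrite /last_node /= !last_cat -loop.
  move: lt0; rewrite !reduced_cost_cat -loop => lt0; lra.
move: (min _ neg') => /=; rewrite !size_cat leq_add2l -[leqRHS]add0n leq_add2r.
by rewrite leqn0 size_eq0 (negbTE l20).
Qed.

(** Each prefix of a shortest negative path that ends at a depot or a station
    is dominated by a generated label.  By induction, such a label dominates
    the prefix without its last leg; the two steps from there to the prefix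
    replace the last leg by a subpath of the first phase that dominates it,
    and then the rest of the prefix by the label. *)
Lemma find_paths_complete P : returns search2 P ->
  (exists p, negative_path p) -> exists2 p, p \in P & negative_path p.
Proof.
move=> /(@returns_exhaustive _ _ _ search2 (dominates_refl res_p)
  (@dominates_trans _ _ _ res_p)).
move=> [G [-> reachG initG closedG]] /shortest_negative_path[[i L] neg min].
have [cp fp rc_lt0] := neg; have [/and3P[_ iD _] L0 lastD] := and3P cp.
have feasG x p : x \in G -> dominates res_p x p -> feasible_path I p ->
    feasible_path I x.
  case: x p => i1 l [i2 l'] /reachG/reached_path[/= ->|//].
  by move=> [/= -> _ _] /(feasible_path_prefix (l1 := [::])).
have fac_i : i \notin customers I by rewrite facility_not_customer inE iD.
(* the induction is on a bound [n] for the length of the prefix *)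
have dom n l l3 : (size l < n)%N -> L = l ++ l3 -> last i l \notin customers I ->
    exists2 q, q \in G & feasible_path I q /\ dominates res_p q (i, l).
  elim: n l l3 => // n IH l l3 size_l EL nc.
  have fl : feasible_path I (i, l).
    by rewrite EL in fp; apply: feasible_path_prefix fp.
  have [E|l0] := eqVneq l [::].
    rewrite {}E in fl *; have [|q qG dq] := initG (i, [::]).
      by rewrite mem_single_nodes iD.
    by exists q => //; split=> //; apply: feasG dq fl.
  have [l1 [l2 [El l20 start cust]]] := last_leg I i l0.
  rewrite {}El in size_l EL nc fl *; rewrite -catA in EL; rewrite last_cat in nc.
  have fl1 : feasible_path I (i, l1) by apply: feasible_path_prefix fl.
  have nc1 : last i l1 \notin customers I by case/orP: start => [/eqP->|].
  have start_or : last i l1 \in stations I \/ l1 = [::] /\ last i l1 \in depots I.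
    have [->|l10] := eqVneq l1 [::]; first by right.
    left; apply: inner_path_station l10 l20 nc1.
    by case: fl.
  have part2 : partial_subpath I (last i l1, l2).
    apply/and3P; split=> //=; last by rewrite -facility_not_customer.
    by case: fl => /and3P[/= + _ _] _ _; rewrite cat_path => /andP[].
  have comp2 : complete_subpath I (last i l1, l2).
    by apply/and3P; split=> //; rewrite -facility_not_customer.
  have feas2 := feasible_subpath_leg fl l20 part2.
  have [|x xS dx] := subpaths_dominating feas2 comp2.
    by apply: (shortest_negative_leg (l3 := l3)) => //; rewrite -EL.
  have [fx cx] := subpaths_feasible xS; have [first_x _ _] := dx.
  have [|q qG [fq dq]] := IH l1 (l2 ++ l3) _ EL nc1.
    rewrite -ltnS (leq_trans _ size_l) // ltnS size_cat -[ltnLHS]addn0 ltn_add2l.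
    by case: (l2) l20.
  have ext2 : subpath_extends I (i, l1) (last i l1, l2).
    rewrite /subpath_extends comp2 /last_node /first_node /= eqxx /=.
    by case: start_or => [->//|[-> ->]]; rewrite orbT.
  have ext_x : subpath_extends I (i, l1) x.
    rewrite /subpath_extends cx first_x /last_node /first_node /= eqxx /=.
    by case: start_or => [->//|[-> ->]]; rewrite orbT.
  have [first_q last_q res_q] := dq.
  have q_start : last i l1 \in stations I \/
      q.2 = [::] /\ last i l1 \in depots I.
    case: start_or => [|[l10 dep]]; [by left | right; split=> //].
    (* the increasing resource sets the single depot i apart from any longer
       label that returns to it *)
    apply/eqP; apply: contraT => q0; have [k lt_k] := reached_path_start_lt.
    move: (lt_k _ (reachG _ qG) q0) (res_q k); rewrite l10.
    by move: first_q; rewrite /first_node /= => ->; rewrite ltNge => /negbTE->.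
  have ext_q : subpath_extends I q x.
    rewrite /subpath_extends cx first_x last_q /last_node /first_node /= eqxx /=.
    by case: q_start => [->//|[-> ->]]; rewrite orbT.
  have ncq : ~~ complete_path I q.
    apply/negP => /and3P[_ q0]; rewrite last_q /last_node /=.
    case: q_start => [sta|[E]]; last by rewrite E in q0.
    by rewrite (disjointFl (depots_stations_disjoint I) sta).
  have [f1x d1x] := domination_iii fx cx feas2 comp2 dx fl1 ext_x ext2 fl.
  have [fqx dqx] := domination_ii fq fl1 dq ext_q ext_x f1x.
  have [|y yG dy] := closedG q x qG ncq _ fqx.
    by rewrite mem_filter ext_q.
  have dyl := dominates_trans dy (dominates_trans dqx d1x).
  by exists y => //; split=> //; apply: feasG dyl fl.
have nc_last : last i L \notin customers I.
  by rewrite facility_not_customer inE -[last i L]/(last_node (i, L)) lastD.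
have [q qG [fq dq]] := dom (size L).+1 L [::] (ltnSn _) (esym (cats0 L)) nc_last.
have [first_q last_q le_q] := dq; have [k cost] := cost_resource.
have rc_q : reduced_cost I kappa mu nu q < 0.
  rewrite -cost; last by split=> //; rewrite last_q.
  by rewrite (le_lt_trans (le_q k)) // cost // -path_reduced_costE.
have cq : complete_path I q.
  have [part _ _] := fq; apply/and3P; split=> //; last by rewrite last_q.
  by case: (q) rc_q => i' [|//]; rewrite reduced_cost_nil ltxx.
by exists q; [rewrite !inE /= qG cq | apply: negative_pathE].
Qed.

End SecondPhase.

Theorem theorem2 (R : realType) (V : finType) (I : instance R V)
    (kappa mu nu : V -> R)
    (Ks : Type) (res_s : Ks -> label V -> R)
    (Kp : Type) (res_p : Kp -> label V -> R)
    (domination_i : forall (s1 s2 : label V) (a : V * V),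
        feasible_subpath I s1 -> feasible_subpath I s2 ->
        dominates res_s s1 s2 ->
        arc_extends I s1 a -> arc_extends I s2 a ->
        feasible_subpath I (add_arc s2 a) ->
        feasible_subpath I (add_arc s1 a) /\
        dominates res_s (add_arc s1 a) (add_arc s2 a))
    (domination_ii : forall p1 p2 s : label V,
        feasible_path I p1 -> feasible_path I p2 ->
        dominates res_p p1 p2 ->
        subpath_extends I p1 s -> subpath_extends I p2 s ->
        feasible_path I (add_subpath p2 s) ->
        feasible_path I (add_subpath p1 s) /\
        dominates res_p (add_subpath p1 s) (add_subpath p2 s))
    (domination_iii : forall s1 s2 p : label V,
        feasible_subpath I s1 -> complete_subpath I s1 ->
        feasible_subpath I s2 -> complete_subpath I s2 ->
        dominates res_s s1 s2 ->
        feasible_path I p ->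
        subpath_extends I p s1 -> subpath_extends I p s2 ->
        feasible_path I (add_subpath p s2) ->
        feasible_path I (add_subpath p s1) /\
        dominates res_p (add_subpath p s1) (add_subpath p s2))
    (cost_resource_s : exists k : Ks, forall s : label V,
        feasible_subpath I s -> res_s k s = reduced_cost I kappa mu nu s)
    (cost_resource_p : exists k : Kp, forall p : label V,
        feasible_path_label I p -> res_p k p = reduced_cost I kappa mu nu p)
    (monotone_resource_s : exists k : Ks,
        [/\ forall s : label V, feasible_subpath I s -> 0 <= res_s k s,
            exists M : R, forall s : label V,
              feasible_subpath I s -> res_s k s <= M
          & forall (s : label V) (a : V * V),
              feasible_subpath I s -> arc_extends I s a ->
              feasible_subpath I (add_arc s a) ->
              res_s k s < res_s k (add_arc s a)])
    (monotone_resource_p : exists k : Kp,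
        [/\ forall p : label V, feasible_path_label I p -> 0 <= res_p k p,
            exists M : R, forall p : label V,
              feasible_path_label I p -> res_p k p <= M
          & forall p s : label V,
              feasible_path_label I p -> subpath_extends I p s ->
              feasible_path I (add_subpath p s) ->
              res_p k p < res_p k (add_subpath p s)]) :
  terminates (find_nondominated_subpaths I res_s) /\
  forall S : {fset label V},
    returns (find_nondominated_subpaths I res_s) S ->
    terminates (find_nondominated_paths I res_p S) /\
    forall P : {fset label V},
      returns (find_nondominated_paths I res_p S) P ->
      ((exists p : label V, [/\ complete_path I p, feasible_path I p
                              & path_reduced_cost I kappa mu nu p < 0]) ->
       exists2 p : label V, p \in P
         & [/\ complete_path I p, feasible_path I p
             & path_reduced_cost I kappa mu nu p < 0]) /\
      (~ (exists p : label V, [/\ complete_path I p, feasible_path I p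
                                & path_reduced_cost I kappa mu nu p < 0]) ->
       forall p : label V, p \in P ->
         ~ (path_reduced_cost I kappa mu nu p < 0)).
Proof.
have incr_s : exists k, forall s a, feasible_subpath I s -> arc_extends I s a ->
    feasible_subpath I (add_arc s a) -> res_s k s < res_s k (add_arc s a).
  by have [k [_ _ incr]] := monotone_resource_s; exists k.
have incr_p : exists k, forall p s, feasible_path_label I p ->
    subpath_extends I p s -> feasible_path I (add_subpath p s) ->
    res_p k p < res_p k (add_subpath p s).
  by have [k [_ _ incr]] := monotone_resource_p; exists k.
split=> [|S retS]; first exact: find_subpaths_terminates.
have [feasS domS] :=
  find_subpaths_dominating domination_i cost_resource_s incr_s retS.
split=> [|P retP]; first exact: find_paths_terminates.
split=> [neg|noneg p pP lt0].
  exact: (find_paths_complete domination_ii domination_iii cost_resource_p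
    incr_p feasS domS retP neg).
by apply: noneg; exists p; apply: find_paths_sound retP pP lt0.
Qed.
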